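(* Let $a,b\in\mathbb{R}$ with $a>0$ and $b\neq 0$, and let $n\in\mathbb{N}$. For integers $j\ge0$ put $$F_{j}(b) = \frac{\binom{2j}{j}}{2^{2j} b^{2j+1}}.$$ Then $$\begin{aligned} \int_{0}^{a} \frac{\ln s \, ds}{(s^{2}+b^{2})^{n+1}} ={}& F_{n}(b) \ln a \,\tan^{-1}(a/b) + \frac{a \ln a}{2} \sum_{k=1}^{n} \frac{F_{n-k}(b)}{k} \sum_{j=0}^{k-1} \frac{F_{j}(b)}{(a^{2}+b^{2})^{k-j}} \\ & - F_{n}(b) \int_{0}^{a/b} \frac{\tan^{-1}x}{x} \, dx - \frac{1}{2}\tan^{-1}(a/b) \left( \sum_{k=1}^{n} \frac{F_{n-k}(b)}{k} \sum_{j=0}^{k-1} F_{j}(b) F_{k-j-1}(b) \right) \\ & - \frac{a}{4 \sqrt{b}} \sum_{k=1}^{n} \frac{F_{n-k}(b)}{k} \sum_{j=0}^{k-1} F_{j}(b) F_{k-j-1}(b) \sum_{r=1}^{k-j-1} \frac{1}{r\,F_{r}(b)\, (a^{2}+b^{2})^{r}}. \end{aligned}$$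
   Context: $\tan^{-1}$ denotes the arctangent function; empty sums are $0$.
   Formalization: The prefactor of the last sum is a/(4b²) instead of the printed a/(4√b), which is undefined for b<0 and makes the identity false for n≥2, b>0, b≠1 (e.g. a=b=2, n=2); the two agree when b=1 and the last sum is empty for n≤1. *)

(* Defs.v *)
From Stdlib Require Import Reals.
From Coquelicot Require Import Coquelicot.

Open Scope R_scope.

(* [Binomial.C] is the real-valued binomial coefficient; plain [C] is shadowed
   by Coquelicot's type of complex numbers. *)
Definition F (b : R) (j : nat) : R :=
  Binomial.C (2 * j) j / (2 ^ (2 * j) * b ^ (2 * j + 1)).

(* The source prints the prefactor of the last sum of the evaluation as
   a / (4 * sqrt b).  This is undefined for b < 0, and for n >= 2 and b > 0 the
   identity then holds only if b = 1.  The prefactor a / (4 * b ^ 2) is the one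
   given by
     \int_0^a ds / (s^2 + b^2)^(m+1)
       = F b m * (atan (a / b)
           + a / (2 * b^2) * \sum_(1 <= r <= m) 1 / (r * F b r * (a^2 + b^2)^r)). *)

(* Main.v *)
Require Import Defs.
From Stdlib Require Import Reals.
From Coquelicot Require Import Coquelicot.
From Stdlib Require Import Arith Lra Lia.
Open Scope R_scope.

(** Write [I_m(s)] for the integral of [1 / (t^2 + b^2)^(m+1)] over [[0, s]].
   Integrating by parts, the integral of [ln s / (s^2 + b^2)^(n+1)] is
   [ln a * I_n(a)] minus the integral of [I_n(s) / s].  The usual reduction
   formula gives [I_m] as [F b m] times
     [atan (s/b) + s / (2 b^2) * sum_(1 <= r <= m) 1 / (r F_r (s^2+b^2)^r)],
   while the convolution identity
     [sum_(0 <= i <= N) F_(N-i) F_i / (r+i) = F_(N+r) / (b^2 r F_r)]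
   rewrites [I_n(s) / s] as a combination of [atan (s/b) / s] and of negative
   powers of [s^2 + b^2], whose integrals are again values of [I_m]. *)

(** * Finite sums: reindexing, exchange of order, termwise derivatives *)

Lemma sum_empty (u : nat -> R) (n m : nat) : (m < n)%nat -> sum_n_m u n m = 0.
Proof. exact (sum_n_m_zero u n m). Qed.

Lemma sum_ext (u v : nat -> R) (n m : nat) :
  (forall k, (n <= k <= m)%nat -> u k = v k) -> sum_n_m u n m = sum_n_m v n m.
Proof. exact (sum_n_m_ext_loc u v n m). Qed.

Lemma sum_recr (u : nat -> R) (n m : nat) :
  (n <= S m)%nat -> sum_n_m u n (S m) = sum_n_m u n m + u (S m).
Proof. intros H; rewrite sum_n_Sm by exact H; reflexivity. Qed.

Lemma sum_recl (u : nat -> R) (n m : nat) :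
  (n <= m)%nat -> sum_n_m u n m = u n + sum_n_m u (S n) m.
Proof. intros H; rewrite sum_Sn_m by exact H; reflexivity. Qed.

Lemma sum_add (u v : nat -> R) (n m : nat) :
  sum_n_m (fun k => u k + v k) n m = sum_n_m u n m + sum_n_m v n m.
Proof. exact (sum_n_m_plus u v n m). Qed.

Lemma sum_scal (c : R) (u : nat -> R) (n m : nat) :
  sum_n_m (fun k => c * u k) n m = c * sum_n_m u n m.
Proof. exact (sum_n_m_mult_l c u n m). Qed.

Lemma sum_rev (u : nat -> R) (p : nat) :
  sum_n_m (fun j => u (S p - j)%nat) 0 p = sum_n_m u 1 (S p).
Proof.
  induction p as [|p IH].
  - now rewrite !sum_n_n.
  - rewrite sum_recl by lia. rewrite <- sum_n_m_S.
    rewrite (sum_recr u 1 (S p)) by lia. rewrite <- IH, Rplus_comm.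
    reflexivity.
Qed.

Lemma sum_rev0 (u : nat -> R) (p : nat) :
  sum_n_m (fun j => u (p - j)%nat) 0 p = sum_n_m u 0 p.
Proof.
  transitivity (sum_n_m (fun r => u (pred r)) 1 (S p)).
  - rewrite <- sum_rev. apply sum_ext; intros k Hk. f_equal; lia.
  - rewrite <- sum_n_m_S. reflexivity.
Qed.

Lemma sum_shift (u : nat -> R) (n m : nat) : (n <= m)%nat ->
  sum_n_m u n m = sum_n_m (fun i => u (n + i)%nat) 0 (m - n).
Proof.
  intros H. induction H as [|m H IH].
  - rewrite Nat.sub_diag, !sum_n_n, Nat.add_0_r. reflexivity.
  - rewrite Nat.sub_succ_l, !sum_recr, IH by lia.
    do 2 f_equal. lia.
Qed.

Lemma sum_triangle (u : nat -> nat -> R) (n : nat) :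
  sum_n_m (fun k => sum_n_m (u k) 1 k) 1 n =
  sum_n_m (fun r => sum_n_m (fun k => u k r) r n) 1 n :> R.
Proof.
  induction n as [|n IH].
  - rewrite !sum_empty by lia. reflexivity.
  (* The new row [k = n + 1] adds one term to every column [r <= n + 1]; column [n + 1] was empty
     before. *)
  - rewrite sum_recr by lia. rewrite IH.
    rewrite (sum_ext (fun r => sum_n_m (fun k => u k r) r (S n))
      (fun r => sum_n_m (fun k => u k r) r n + u (S n) r))
      by (intros k Hk; apply sum_recr; lia).
    rewrite sum_add. rewrite (sum_recr (fun r => sum_n_m _ r n)) by lia.
    rewrite (sum_empty _ (S n) n) by lia.
    ring.
Qed.

Lemma is_derive_sum_n_m (f : nat -> R -> R) (d : nat -> R) (n m : nat) (x : R) :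
  (forall k, (n <= k <= m)%nat -> is_derive (f k) x (d k)) ->
  is_derive (fun y => sum_n_m (fun k => f k y) n m) x (sum_n_m d n m).
Proof.
  destruct (le_lt_dec n m) as [Hnm|Hnm].
  - intros H. rewrite sum_shift by exact Hnm.
    apply (is_derive_ext (fun y => sum_n (fun i => f (n + i)%nat y) (m - n))).
    + intros y. symmetry. now apply sum_shift.
    + apply (is_derive_sum_n (V := R_NormedModule) (fun i => f (n + i)%nat)
        (m - n) x (fun i => d (n + i)%nat)).
      intros k Hk. apply H. lia.
  - intros _. rewrite sum_empty by exact Hnm.
    apply (is_derive_ext (fun _ => 0)).
    + intros y. rewrite sum_empty by exact Hnm. reflexivity.
    + exact (is_derive_const 0 x).
Qed.

(** * The coefficients [F b j] and their weighted convolution *)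

Lemma F_0 (b : R) (hb : b <> 0) : F b 0 = / b.
Proof.
  unfold F, Binomial.C. simpl. field. exact hb.
Qed.

(** Ratio 2(2j+1)/(j+1) of consecutive central binomial coefficients, divided by 4 b^2; every later
    induction on [F] rests on it. *)
Lemma F_S (b : R) (hb : b <> 0) (j : nat) :
  F b (S j) = F b j * (2 * INR j + 1) / (2 * (INR j + 1) * b ^ 2).
Proof.
  unfold F, Binomial.C.
  replace (2 * S j - S j)%nat with (S j) by lia.
  replace (2 * j - j)%nat with j by lia.
  replace (2 * S j)%nat with (S (S (2 * j))) by lia.
  replace (S (S (2 * j)) + 1)%nat with (S (S (2 * j + 1))) by lia.
  rewrite !fact_simpl, !mult_INR, !S_INR, mult_INR.
  rewrite <- !tech_pow_Rmult. simpl (INR 2).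
  assert (INR (fact j) <> 0) by apply INR_fact_neq_0.
  assert (b ^ (2 * j + 1) <> 0) by now apply pow_nonzero.
  assert (2 ^ (2 * j) <> 0) by (apply pow_nonzero; lra).
  assert (0 <= INR j) by apply pos_INR.
  field. repeat split; try assumption; lra.
Qed.

Lemma F_neq_0 (b : R) (hb : b <> 0) (j : nat) : F b j <> 0.
Proof.
  induction j as [|j IH].
  - rewrite (F_0 b hb). now apply Rinv_neq_0_compat.
  - rewrite (F_S b hb). assert (0 <= INR j) by apply pos_INR.
    assert (b ^ 2 <> 0) by now apply pow_nonzero.
    apply Rmult_integral_contrapositive_currified.
    + apply Rmult_integral_contrapositive_currified; [exact IH|lra].
    + apply Rinv_neq_0_compat.
      apply Rmult_integral_contrapositive_currified; [lra|assumption].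
Qed.

Definition F_conv (b x : R) (N : nat) : R :=
  sum_n_m (fun i => F b (N - i) * F b i / (x + INR i)) 0 N.

(* Zeilberger's recurrence for the convolution: the inhomogeneous term does
   not depend on [x]. *)
Lemma F_conv_S (b : R) (hb : b <> 0) (x : R) (N : nat) : 0 < x ->
  b ^ 2 * (x + INR N + 1) * F_conv b x (S N) =
  (x + INR N + 1 / 2) * F_conv b x N + b * F b (S N) - 1 / 2 * F_conv b 1 N.
Proof.
  intros Hx. unfold F_conv at 1. rewrite sum_recr by lia.
  rewrite Nat.sub_diag, (F_0 b hb), Rmult_plus_distr_l.
  (* Reversing the sum turns the weight 1/(1+i) into 1/(N-i+1), the denominator that [F_S] produces
     from [F b (S (N - i))]. *)
  assert (Hrev : F_conv b 1 N =
    sum_n_m (fun i => F b (N - i) * F b i / (INR N - INR i + 1)) 0 N).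
  { unfold F_conv. rewrite <- sum_rev0. apply sum_ext.
    intros k Hk. replace (N - (N - k))%nat with k by lia.
    rewrite (minus_INR N k) by lia.
    rewrite (Rplus_comm 1), (Rmult_comm (F b k)). reflexivity. }
  rewrite Hrev. unfold F_conv. rewrite <- !sum_scal.
  (* Partial fractions: with u = x+i and v = N-i+1, so that u+v = x+N+1, one has (u+v)(v-1/2)/(uv) =
     (u+v-1/2)/u - 1/(2v). *)
  rewrite (sum_ext _ (fun i =>
    (x + INR N + 1 / 2) * (F b (N - i) * F b i / (x + INR i)) +
    (- (1 / 2)) * (F b (N - i) * F b i / (INR N - INR i + 1)))).
  - rewrite sum_add, !sum_scal, S_INR.
    assert (0 <= INR N) by apply pos_INR. field.
    split; [assumption|lra].
  - intros k Hk. replace (S N - k)%nat with (S (N - k)) by lia.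
    rewrite (F_S b hb), minus_INR by lia.
    assert (0 <= INR k) by apply pos_INR.
    assert (INR k <= INR N) by (apply le_INR; lia).
    field. repeat split; try assumption; lra.
Qed.

(** At [x = 1] the recurrence involves no other convolution, so it closes by induction. The value
    shows that the inhomogeneous term b F_(N+1) - (1/2) [F_conv b 1 N] is zero. *)
Lemma F_conv_1 (b : R) (hb : b <> 0) (N : nat) : F_conv b 1 N = 2 * b * F b (S N).
Proof.
  induction N as [|N IH].
  - unfold F_conv. rewrite sum_n_n, (F_S b hb). simpl. rewrite (F_0 b hb). field. exact hb.
  - assert (0 <= INR N) by apply pos_INR.
    assert (H2 : b ^ 2 <> 0) by now apply pow_nonzero.
    assert (H3 : 1 + INR N + 1 <> 0) by lra.
    apply (Rmult_eq_reg_l (b ^ 2 * (1 + INR N + 1)));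
      [|now apply Rmult_integral_contrapositive_currified].
    rewrite (F_conv_S b hb), IH by lra. rewrite (F_S b hb (S N)), S_INR. field.
    split; [exact hb|lra].
Qed.

(** Since the inhomogeneous term vanishes by [F_conv_1], each step in [N] multiplies by
    (r+N+1/2)/(b^2 (r+N+1)), which is also the ratio of [F b (N + r)] given by [F_S]. *)
Lemma F_conv_eq (b : R) (hb : b <> 0) (r N : nat) : (1 <= r)%nat ->
  F_conv b (INR r) N = F b (N + r) / (b ^ 2 * (INR r * F b r)).
Proof.
  intros Hr. assert (Hr' : 1 <= INR r) by now apply (le_INR 1).
  assert (HF := F_neq_0 b hb r).
  induction N as [|N IH].
  - unfold F_conv. rewrite sum_n_n. simpl. rewrite (F_0 b hb). field.
    repeat split; try assumption; lra.
  - assert (0 <= INR N) by apply pos_INR.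
    assert (H2 : b ^ 2 <> 0) by now apply pow_nonzero.
    assert (H3 : INR r + INR N + 1 <> 0) by lra.
    apply (Rmult_eq_reg_l (b ^ 2 * (INR r + INR N + 1)));
      [|now apply Rmult_integral_contrapositive_currified].
    rewrite (F_conv_S b hb), IH, (F_conv_1 b hb) by lra.
    simpl (S N + r)%nat. rewrite (F_S b hb), (F_S b hb (N + r)), plus_INR.
    field. repeat split; try assumption; lra.
Qed.

(** Put r = k-j and exchange the sums: the coefficient of 1/D^r becomes [F_conv b (INR r) (n - r)],
    which [F_conv_eq] evaluates. *)
Lemma double_sum_eq (b : R) (hb : b <> 0) (D : R) (n : nat) : D <> 0 ->
  sum_n_m (fun k => F b (n - k) / INR k *
    sum_n_m (fun j => F b j / D ^ (k - j)) 0 (k - 1)) 1 n =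
  F b n / b ^ 2 * sum_n_m (fun r => 1 / (INR r * F b r * D ^ r)) 1 n.
Proof.
  intros HD.
  rewrite (sum_ext _ (fun k => sum_n_m (fun r =>
    F b (n - k) / INR k * (F b (k - r) / D ^ r)) 1 k)).
  - rewrite sum_triangle, <- sum_scal. apply sum_ext. intros r Hr.
    rewrite sum_shift by lia.
    transitivity (/ D ^ r * F_conv b (INR r) (n - r)).
    + unfold F_conv. rewrite <- sum_scal. apply sum_ext. intros i Hi.
      replace (n - (r + i))%nat with (n - r - i)%nat by lia.
      replace (r + i - r)%nat with i by lia. rewrite plus_INR.
      assert (1 <= INR r) by (apply (le_INR 1); lia).
      assert (0 <= INR i) by apply pos_INR.
      field. split; [lra | now apply pow_nonzero].
    + rewrite (F_conv_eq b hb) by lia. replace (n - r + r)%nat with n by lia.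
      assert (1 <= INR r) by (apply (le_INR 1); lia).
      field. repeat split; try assumption; try apply (F_neq_0 b hb); try lra.
      now apply pow_nonzero.
  - intros k Hk. rewrite sum_scal. f_equal. destruct k as [|p]; [lia|].
    rewrite <- sum_rev. replace (S p - 1)%nat with p by lia.
    apply sum_ext. intros j Hj.
    replace (S p - (S p - j))%nat with j by lia. reflexivity.
Qed.

(** * The closed form of I_m and its derivative *)

Definition pow_integral (b : R) (m : nat) (s : R) : R :=
  F b m * (atan (s / b) + s / (2 * b ^ 2) *
    sum_n_m (fun r => 1 / (INR r * F b r * (s ^ 2 + b ^ 2) ^ r)) 1 m).

Lemma denom_pos (b : R) (hb : b <> 0) (s : R) : 0 < s ^ 2 + b ^ 2.
Proof. assert (0 < b * b) by nra. nra. Qed.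

Lemma pow_integral_0 (b : R) (hb : b <> 0) (m : nat) : pow_integral b m 0 = 0.
Proof.
  unfold pow_integral. replace (0 / b) with 0 by (field; exact hb).
  rewrite atan_0. field. exact hb.
Qed.

Lemma is_derive_pow_integral (b : R) (hb : b <> 0) (m : nat) (s : R) :
  is_derive (pow_integral b m) s (/ (s ^ 2 + b ^ 2) ^ (m + 1)).
Proof.
  assert (HD := denom_pos b hb s).
  induction m as [|m IH].
  - apply (is_derive_ext (fun s => / b * atan (s / b))).
    + intros t. unfold pow_integral. rewrite sum_empty by lia.
      rewrite (F_0 b hb), Rmult_0_r, Rplus_0_r. reflexivity.
    + auto_derive; [exact I|]. simpl. unfold Rsqr. field.
      repeat split; try assumption; nra.
  - assert (0 <= INR m) by apply pos_INR.
    (* The reduction formula expressing I_(m+1) through I_m: [F_S] rescales the old terms, and in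
       the new summand r = m+1 the factor [F b (S m)] cancels. *)
    apply (is_derive_ext (fun s =>
      (2 * INR m + 1) / (2 * (INR m + 1) * b ^ 2) * pow_integral b m s +
      s / (2 * (INR m + 1) * b ^ 2 * (s ^ 2 + b ^ 2) ^ (S m)))).
    + intros t. unfold pow_integral. rewrite sum_recr by lia.
      assert (HF := F_neq_0 b hb m). rewrite (F_S b hb m), S_INR.
      assert (Ht := denom_pos b hb t).
      assert ((t ^ 2 + b ^ 2) ^ S m <> 0) by (apply pow_nonzero; lra).
      generalize dependent ((t ^ 2 + b ^ 2) ^ S m). intros D HD'.
      match goal with |- @eq _ ?x ?y => change (@eq R x y) end.
      field. repeat split; try assumption; lra.
    + evar_last.
      * apply (is_derive_plus (V := R_NormedModule)).
        -- apply is_derive_scal. exact IH.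
        -- auto_derive; [|reflexivity].
           change (s * (s * 1)) with (s ^ 2). change (b * (b * 1)) with (b ^ 2).
           assert (0 < b ^ 2) by (simpl; nra).
           repeat apply Rmult_integral_contrapositive_currified;
             try (apply pow_nonzero; lra); lra.
      * change (match m with 0%nat => 1 | S _ => INR m + 1 end) with (INR (S m)).
        change (s * (s * 1)) with (s ^ 2). change (b * (b * 1)) with (b ^ 2).
        rewrite !Nat.add_1_r, <- !(tech_pow_Rmult (s ^ 2 + b ^ 2)), S_INR.
        assert (HP : (s ^ 2 + b ^ 2) ^ m <> 0) by (apply pow_nonzero; lra).
        generalize dependent ((s ^ 2 + b ^ 2) ^ m). intros P HP.
        match goal with
        | |- @eq _ (plus ?x ?y) ?z => change (@eq R (x + y) z)
        end.
        field. repeat split; try assumption; try lra.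
Qed.

(** * The integral of atan x / x *)

(* [atan x / x] is [0] at [x = 0] in Rocq; [1] is the continuous extension. *)
Definition atan_div (x : R) : R := if Req_EM_T x 0 then 1 else atan x / x.

Lemma mul_atan_div (x : R) : x * atan_div x = atan x.
Proof.
  unfold atan_div. destruct (Req_EM_T x 0) as [->|Hx].
  - rewrite atan_0. ring.
  - field. exact Hx.
Qed.

Lemma continuous_atan_div (x : R) : continuous atan_div x.
Proof.
  destruct (Req_dec x 0) as [->|Hx].
  - apply continuity_pt_filterlim. apply continuity_pt_locally. intros eps.
    (* The difference quotient of [atan] at 0 is atan y / y, so atan'(0) = 1 is exactly the required
       continuity. *)
    destruct (derivable_pt_lim_atan 0 eps (cond_pos eps)) as [d Hd].
    exists d. intros y Hy. change (Rabs (y - 0) < d) in Hy.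
    rewrite Rminus_0_r in Hy. unfold atan_div.
    destruct (Req_EM_T 0 0) as [_|]; [|easy].
    destruct (Req_EM_T y 0) as [_|Hy0].
    + rewrite Rminus_diag, Rabs_R0. apply cond_pos.
    + specialize (Hd y Hy0 Hy). rewrite Rplus_0_l, atan_0, Rminus_0_r in Hd.
      replace (/ (1 + 0 ^ 2)) with 1 in Hd by (simpl; field). exact Hd.
  - apply (continuous_ext_loc _ (fun y => atan y / y)).
    + exists (mkposreal _ (Rabs_pos_lt x Hx)). intros y Hy.
      change (Rabs (y - x) < Rabs x) in Hy. unfold atan_div.
      destruct (Req_EM_T y 0) as [->|_]; [|reflexivity].
      rewrite Rminus_0_l, Rabs_Ropp in Hy. lra.
    + apply (ex_derive_continuous (V := R_NormedModule)).
      auto_derive. exact Hx.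
Qed.

(** The integrands can differ only at 0, which is an endpoint whatever the sign of [x]. *)
Lemma RInt_atan_div (x : R) :
  RInt (fun t => atan t / t) 0 x = RInt atan_div 0 x.
Proof.
  apply RInt_ext. intros t Ht. unfold atan_div.
  destruct (Req_EM_T t 0) as [->|_]; [|reflexivity].
  unfold Rmin, Rmax in Ht. destruct (Rle_dec 0 x); lra.
Qed.

Lemma is_derive_RInt_atan_div (x : R) :
  is_derive (fun y => RInt atan_div 0 y) x (atan_div x).
Proof.
  apply (is_derive_RInt (V := R_NormedModule) atan_div _ 0).
  - apply filter_forall. intros y.
    apply (RInt_correct (V := R_CompleteNormedModule)).
    apply (ex_RInt_continuous (V := R_CompleteNormedModule)).
    intros z _. apply continuous_atan_div.
  - apply continuous_atan_div.
Qed.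

(** * Improper integrals at 0 from the right *)

Lemma is_lim_mul_ln_0 : filterlim (fun x => x * ln x) (at_right 0) (locally 0).
Proof.
  (* Substituting y = 1/x reduces the claim to ln y / y -> 0 at infinity. *)
  apply (filterlim_ext_loc (fun x => - (ln (/ x) / / x))).
  - exists (mkposreal 1 Rlt_0_1). intros x _ Hx.
    rewrite ln_Rinv by exact Hx. field. lra.
  - apply (filterlim_comp _ _ _ (fun x => ln (/ x) / / x) Ropp _ (locally 0)).
    + apply (filterlim_comp _ _ _ Rinv (fun y => ln y / y) _
        (Rbar_locally p_infty)).
      * exact filterlim_Rinv_0_right.
      * exact is_lim_div_ln_p.
    + replace 0 with (- 0) at 2 by ring.
      apply (filterlim_opp (V := R_NormedModule)).
Qed.

(** The fundamental theorem of calculus gives H a - H x between x > 0 and a; then x tends to 0. *)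
Lemma is_RInt_gen_derive_at_right (f H : R -> R) (a l : R) : 0 < a ->
  (forall x, 0 < x -> is_derive H x (f x)) ->
  (forall x, 0 < x -> continuous f x) ->
  filterlim H (at_right 0) (locally l) ->
  is_RInt_gen f (at_right 0) (at_point a) (H a - l).
Proof.
  intros ha Hd Hc Hl P HP.
  assert (Hm : filterlim (fun x => H a - H x) (at_right 0)
    (locally (H a - l))).
  { apply (filterlim_comp _ _ _ H (fun y => H a - y) _ (locally l)).
    - exact Hl.
    - apply (continuous_minus (V := R_NormedModule) (fun _ => H a) (fun y => y)).
      + apply continuous_const.
      + apply continuous_id. }
  apply (Filter_prod _ _ _ (fun x => 0 < x /\ P (H a - H x)) (fun y => y = a)).
  - apply filter_and.
    + exists (mkposreal 1 Rlt_0_1). intros x _ Hx. exact Hx.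
    + exact (Hm P HP).
  - reflexivity.
  - intros x y [Hx HPx] ->. exists (H a - H x). split; [|exact HPx].
    (* Whichever of [x] and [a] is larger, the segment between them stays in the positive
       half-line. *)
    assert (0 < Rmin x a) by now apply Rmin_glb_lt.
    apply (is_RInt_derive (V := R_CompleteNormedModule)); intros z Hz;
      [apply Hd|apply Hc]; simpl in Hz; lra.
Qed.

(** * The primitive from integration by parts, and its limit at 0 *)

(** The double sum of [double_sum_eq] at D = s^2+b^2, integrated term by term: 1/D^(k-j) becomes
    I_(k-j-1)(s). Half of it is the integral of the non-arctangent part of I_n(s)/s. *)
Definition ibp_correction (b : R) (n : nat) (s : R) : R :=
  sum_n_m (fun k => F b (n - k) / INR k *
    sum_n_m (fun j => F b j * pow_integral b (k - j - 1) s) 0 (k - 1)) 1 n.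

Lemma is_derive_ibp_correction (b : R) (hb : b <> 0) (n : nat) (s : R) :
  is_derive (ibp_correction b n) s
    (F b n / b ^ 2 *
       sum_n_m (fun r => 1 / (INR r * F b r * (s ^ 2 + b ^ 2) ^ r)) 1 n).
Proof.
  rewrite <- double_sum_eq by (exact hb || (pose proof (denom_pos b hb s); lra)).
  apply is_derive_sum_n_m. intros k Hk. apply is_derive_scal.
  apply (is_derive_sum_n_m (fun j y => F b j * pow_integral b (k - j - 1) y)).
  intros j Hj. evar_last.
  - apply is_derive_scal, is_derive_pow_integral, hb.
  (* The exponent (k-j-1)+1 equals k-j because j <= k-1 and k >= 1. *)
  - rewrite Nat.sub_add by lia. reflexivity.
Qed.

Lemma ibp_correction_0 (b : R) (hb : b <> 0) (n : nat) :
  ibp_correction b n 0 = 0.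
Proof.
  unfold ibp_correction.
  rewrite (sum_ext _ (fun _ => 0)), sum_n_m_const; [ring|].
  intros k _. rewrite (sum_ext _ (fun _ => 0)), sum_n_m_const; [ring|].
  intros j _. rewrite pow_integral_0 by exact hb. ring.
Qed.

(** ln s I_n(s) minus the integral of I_n(t)/t over [0, s], the latter split into its arctangent and
    rational parts. *)
Definition ln_primitive (b : R) (n : nat) (s : R) : R :=
  ln s * pow_integral b n s - F b n * RInt atan_div 0 (s / b)
  - 1 / 2 * ibp_correction b n s.

Lemma is_derive_ln_primitive (b : R) (hb : b <> 0) (n : nat) (s : R) : 0 < s ->
  is_derive (ln_primitive b n) s (ln s / (s ^ 2 + b ^ 2) ^ (n + 1)).
Proof.
  intros Hs. unfold ln_primitive. evar_last.
  - apply (is_derive_minus (V := R_NormedModule));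
      [apply (is_derive_minus (V := R_NormedModule))|].
    + apply (is_derive_mult ln (pow_integral b n) s).
      * apply is_derive_ln. exact Hs.
      * apply is_derive_pow_integral, hb.
      * intros x y. apply Rmult_comm.
    + apply is_derive_scal.
      apply (is_derive_comp (V := R_NormedModule) (fun y => RInt atan_div 0 y)
        (fun t => t / b)).
      * apply is_derive_RInt_atan_div.
      * apply (is_derive_ext (fun t => / b * t)).
        -- intros t. apply Rmult_comm.
        -- apply is_derive_scal, is_derive_id.
    + apply is_derive_scal. apply is_derive_ibp_correction, hb.
  - unfold minus, plus, opp, scal, mult, one; simpl.
    (* Writing atan (s/b) as (s/b) [atan_div (s / b)] lets the terms from the derivative of ln and
       from the arctangent integral cancel. *)
    unfold mult, pow_integral; simpl. rewrite <- mul_atan_div.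
    change (s * (s * 1)) with (s ^ 2). change (b * (b * 1)) with (b ^ 2).
    assert (HD : (s ^ 2 + b ^ 2) ^ (n + 1) <> 0).
    { apply pow_nonzero. pose proof (denom_pos b hb s). lra. }
    match goal with |- @eq _ ?x ?y => change (@eq R x y) end.
    generalize dependent ((s ^ 2 + b ^ 2) ^ (n + 1)). intros D HD.
    field. repeat split; try assumption; lra.
Qed.

(** I_n(s) = s q(s) with q continuous at 0, so ln s I_n(s) = (s ln s) q(s) tends to 0; the remaining
    terms p are continuous and vanish at 0. *)
Lemma ln_primitive_lim_0 (b : R) (hb : b <> 0) (n : nat) :
  filterlim (ln_primitive b n) (at_right 0) (locally 0).
Proof.
  assert (Hb := denom_pos b hb).
  set (q := fun s => F b n * (/ b * atan_div (s / b) + 1 / (2 * b ^ 2) *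
    sum_n_m (fun r => 1 / (INR r * F b r * (s ^ 2 + b ^ 2) ^ r)) 1 n)).
  set (p := fun s => F b n * RInt atan_div 0 (s / b)
    + 1 / 2 * ibp_correction b n s).
  assert (Hscale : forall s, is_derive (fun t => t / b) s (/ b)).
  { intros s. auto_derive; [exact I|field; exact hb]. }
  assert (Hq : continuous q 0).
  { apply (continuous_scal_r (V := R_NormedModule)).
    apply (continuous_plus (V := R_NormedModule)).
    - apply (continuous_scal_r (V := R_NormedModule)).
      apply (continuous_comp (fun t => t / b) atan_div).
      + apply (ex_derive_continuous (V := R_NormedModule)).
        eexists; apply Hscale.
      + apply continuous_atan_div.
    - apply (continuous_scal_r (V := R_NormedModule)).
      apply (ex_derive_continuous (V := R_NormedModule)).
      eexists. apply is_derive_sum_n_m. intros k Hk. apply Derive_correct.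
      assert (HF := F_neq_0 b hb k). generalize dependent (F b k). intros f Hf.
      auto_derive. specialize (Hb 0).
      assert (1 <= INR k) by (apply (le_INR 1); lia).
      repeat apply Rmult_integral_contrapositive_currified;
        [lra|exact Hf|apply pow_nonzero; simpl in Hb; lra]. }
  assert (Hp : continuous p 0).
  { apply (continuous_plus (V := R_NormedModule));
      apply (continuous_scal_r (V := R_NormedModule)).
    - apply (continuous_comp (fun t => t / b) (fun y => RInt atan_div 0 y)).
      + apply (ex_derive_continuous (V := R_NormedModule)).
        eexists; apply Hscale.
      + apply (ex_derive_continuous (V := R_NormedModule)).
        eexists; apply is_derive_RInt_atan_div.
    - apply (ex_derive_continuous (V := R_NormedModule)).
      eexists; now apply is_derive_ibp_correction. }
  assert (p 0 = 0) as Hp0.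
  { unfold p. rewrite ibp_correction_0 by exact hb.
    replace (0 / b) with 0 by (field; exact hb).
    rewrite RInt_point. unfold zero; simpl. ring. }
  apply (filterlim_ext (fun s => s * ln s * q s - p s)).
  { intros s. unfold ln_primitive, p, q, pow_integral.
    rewrite <- mul_atan_div. field. exact hb. }
  enough (Hl : filterlim (fun s => s * ln s * q s - p s) (at_right 0)
    (locally (0 * q 0 - p 0))).
  { replace (0 * q 0 - p 0) with 0 in Hl by (rewrite Hp0; ring). exact Hl. }
  assert (Hr : filter_le (at_right 0) (locally 0)) by apply filter_le_within.
  refine (filterlim_comp_2 (fun s => s * ln s * q s) (fun s => - p s) Rplus
    (G := locally (0 * q 0)) (H := locally (- p 0)) _ _ _).
  - refine (filterlim_comp_2 (fun s => s * ln s) q Rmult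
      is_lim_mul_ln_0 (filterlim_filter_le_1 q Hr Hq) _).
    exact (filterlim_mult (K := R_AbsRing) 0 (q 0)).
  - apply (filterlim_comp _ _ _ p Ropp _ (locally (p 0))).
    + exact (filterlim_filter_le_1 p Hr Hp).
    + apply (filterlim_opp (V := R_NormedModule)).
  - exact (filterlim_plus (V := R_NormedModule) (0 * q 0) (- p 0)).
Qed.

Theorem theorem6p9 (a b : R) (n : nat) (ha : 0 < a) (hb : b <> 0) :
  is_RInt_gen (fun s : R => ln s / (s ^ 2 + b ^ 2) ^ (n + 1))
    (at_right 0) (at_point a)
    (F b n * ln a * atan (a / b)
     + a * ln a / 2 *
         sum_n_m (fun k : nat => F b (n - k) / INR k *
           sum_n_m (fun j : nat => F b j / (a ^ 2 + b ^ 2) ^ (k - j)) 0 (k - 1)) 1 n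
     - F b n * RInt (fun x : R => atan x / x) 0 (a / b)
     - 1 / 2 * atan (a / b) *
         sum_n_m (fun k : nat => F b (n - k) / INR k *
           sum_n_m (fun j : nat => F b j * F b (k - j - 1)) 0 (k - 1)) 1 n
     - a / (4 * b ^ 2) *
         sum_n_m (fun k : nat => F b (n - k) / INR k *
           sum_n_m (fun j : nat => F b j * F b (k - j - 1) *
             sum_n_m (fun r : nat => 1 / (INR r * F b r * (a ^ 2 + b ^ 2) ^ r))
               1 (k - j - 1)) 0 (k - 1)) 1 n).
Proof.
  assert (HD := denom_pos b hb).
  match goal with |- is_RInt_gen _ _ _ ?l =>
    replace l with (ln_primitive b n a - 0) end.
  - apply is_RInt_gen_derive_at_right.
    + exact ha.
    + intros s Hs. now apply is_derive_ln_primitive.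
    + intros s Hs. apply (ex_derive_continuous (V := R_NormedModule)).
      auto_derive. specialize (HD s). split; [exact Hs|].
      split; [|exact I]. apply pow_nonzero. simpl in HD. lra.
    + now apply ln_primitive_lim_0.
  - rewrite RInt_atan_div, double_sum_eq by (exact hb || specialize (HD a); lra).
    unfold ln_primitive.
    (* Splitting each I_(k-j-1)(a) into its arctangent and rational parts yields the last two sums;
       the factor 1/2 in [ln_primitive] turns a/(2 b^2) into a/(4 b^2). *)
    assert (ibp_correction b n a =
      atan (a / b) * sum_n_m (fun k => F b (n - k) / INR k *
        sum_n_m (fun j => F b j * F b (k - j - 1)) 0 (k - 1)) 1 n +
      a / (2 * b ^ 2) * sum_n_m (fun k => F b (n - k) / INR k *
        sum_n_m (fun j => F b j * F b (k - j - 1) *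
          sum_n_m (fun r => 1 / (INR r * F b r * (a ^ 2 + b ^ 2) ^ r))
            1 (k - j - 1)) 0 (k - 1)) 1 n) as ->.
    { rewrite <- !sum_scal, <- sum_add. apply sum_ext. intros k Hk.
      match goal with |- ?c * _ = ?x * (?c * ?s) + ?y * (?c * ?t) =>
        transitivity (c * (x * s + y * t)); [|ring] end.
      f_equal. rewrite <- !sum_scal, <- sum_add. apply sum_ext. intros j Hj. unfold pow_integral. ring. }
    unfold pow_integral. field. exact hb.
Qed.
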